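(* Let $X\subset\mathbb R^d$ be the closure of a bounded connected open set with smooth boundary, $Y\subset\mathbb R^{d'}$ compact, $\mu$ a Lebesgue-absolutely continuous probability measure on $X$ with density bounded from above and away from zero and $\int_X|\nabla\sqrt\mu|^2\,\mathrm dx<\infty$, and $\nu$ a probability measure on $Y$. Let $V\in C^2(X\times Y)$ be non-negative and satisfy the twist condition: $\nabla_XV(x,\cdot)$ is injective on $Y$ for every $x\in X$. Let $\Pi_*\in C^2(X)$ be such that the map $T_*(x)=\nabla_XV(x,\cdot)^{-1}(\nabla\Pi_*(x))$ from $X$ to $Y$ is well defined and satisfies $T_{*\sharp}\mu=\nu$, and let $\rho_0=(\mathrm{id},T_* )_\sharp\mu$. Then, for all sufficiently small $\tau>0$, $\rho_0$ is a minimizer over $\rho\in\Gamma(\mu,\nu)$ of $$\frac1{2\tau}\mathbf W_F(\rho,\rho_0)^2+\int_{X\times Y}V\,\mathrm d\rho,$$ i.e. $\rho_0$ is a stationary point of the minimizing movement scheme with $\kappa=0$.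
   Context: $\nabla_X$ is the gradient in the variable $x\in X$. $\Gamma(\mu,\nu)$ is the set of probability measures on $X\times Y$ with marginals $\mu$ and $\nu$. $\mathbf W$ is the 2-Wasserstein distance; for $\rho_1,\rho_2$ on $X\times Y$ with common second marginal $\nu$ and disintegrations $(\rho_{i,y})_{y\in Y}$ with respect to $\nu$, the fiber-wise Wasserstein distance is $\mathbf W_F(\rho_1,\rho_2)^2=\int_Y\mathbf W(\rho_{1,y},\rho_{2,y})^2\,\mathrm d\nu(y)$. The minimizing movement scheme with $\kappa=0$ chooses $\rho_\tau^n$ as a minimizer over $\Gamma(\mu,\nu)$ of $\frac1{2\tau}\mathbf W_F(\rho,\rho_\tau^{n-1})^2+\int V\,\mathrm d\rho$. *)

(* Defs.v *)
From HB Require Import structures.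
From mathcomp Require Import all_boot all_order all_algebra.
From mathcomp Require Import all_classical all_reals all_analysis.

Set Implicit Arguments.
Unset Strict Implicit.
Unset Printing Implicit Defensive.

Import Order.TTheory GRing.Theory Num.Theory.
Import numFieldNormedType.Exports.

Local Open Scope classical_set_scope.
Local Open Scope ring_scope.

(* R^d is 'rV[R]_d, with its Borel sigma-algebra, generated by the coordinates.
   The norm of 'rV[R]_d is the sup norm: below it is only used through the
   topology, and Euclidean lengths are given by [sqnorm]. *)
Definition rV_coord (R : realType) (d : nat) (i : 'I_d) (x : 'rV[R]_d) : R :=
  x ord0 i.

Fact rV_display : measure_display.
Proof. exact: default_measure_display. Qed.

Section rV_measurable.
Context {R : realType} {d : nat}.

Let rV_set0 : g_sigma_preimage (@rV_coord R d) set0.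
Proof. exact: sigma_algebra0. Qed.

Let rV_setC A : g_sigma_preimage (@rV_coord R d) A ->
  g_sigma_preimage (@rV_coord R d) (~` A).
Proof. exact: sigma_algebraC. Qed.

Let rV_bigcup (F : (set 'rV[R]_d)^nat) :
  (forall i, g_sigma_preimage (@rV_coord R d) (F i)) ->
  g_sigma_preimage (@rV_coord R d) (\bigcup_i F i).
Proof. exact: sigma_algebra_bigcup. Qed.

HB.instance Definition _ :=
  @isMeasurable.Build rV_display 'rV[R]_d (g_sigma_preimage (@rV_coord R d))
    rV_set0 rV_setC rV_bigcup.

End rV_measurable.

Lemma measurable_rV_coord (R : realType) (d : nat) (i : 'I_d) :
  measurable_fun [set: 'rV[R]_d] (rV_coord i).
Proof.
move=> _ Y mY; rewrite setTI; apply: sub_sigma_algebra => /=.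
rewrite -bigcup_seq/=; exists i => /=; first by rewrite mem_index_enum.
by exists Y => //; rewrite setTI.
Qed.

Lemma measurable_fun_rVP (R : realType) d1 (T : measurableType d1) (d : nat)
    (f : T -> 'rV[R]_d) :
  (forall i, measurable_fun [set: T] (rV_coord i \o f)) ->
  measurable_fun [set: T] f.
Proof.
move=> mf.
have sub : g_sigma_preimage (fun i => rV_coord i \o f) `<=` measurable.
  apply: smallest_sub; first exact: sigma_algebra_measurable.
  case: d f mf => [|d] f mf; first by rewrite big_ord0.
  rewrite -bigcup_mkord_ord; apply: bigcup_sub => i Ii.
  by move=> A [B mB <-]; exact: mf.
move=> _ A mA; apply: sub.
by rewrite g_sigma_preimage_comp; exists A.
Qed.

Section rV_cons.
Context {R : realType} {d : nat}.

Definition rV_cons (z : measurableTypeR R * 'rV[R]_d) : 'rV[R]_d.+1 :=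
  \row_i (if unlift ord0 i is Some j then z.2 ord0 j else z.1).

Definition rV_uncons (x : 'rV[R]_d.+1) : measurableTypeR R * 'rV[R]_d :=
  (x ord0 ord0, \row_j x ord0 (lift ord0 j)).

Lemma measurable_rV_cons : measurable_fun [set: _] rV_cons.
Proof.
apply: measurable_fun_rVP => i.
case: (unliftP ord0 i) => [j ->|->].
- rewrite (_ : _ \o _ = rV_coord j \o snd).
    by apply: measurableT_comp => //; exact: measurable_rV_coord.
  by apply/funext => z; rewrite /rV_coord /= mxE liftK.
- rewrite (_ : _ \o _ = fst); first exact: measurable_fst.
  by apply/funext => z; rewrite /rV_coord /= mxE unlift_none.
Qed.

Lemma measurable_rV_uncons : measurable_fun [set: _] rV_uncons.
Proof.
apply/measurable_fun_pairP; split.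
- exact: (@measurable_rV_coord R d.+1 ord0).
- apply: measurable_fun_rVP => j.
  rewrite (_ : _ \o _ = rV_coord (lift ord0 j)).
    exact: measurable_rV_coord.
  by apply/funext => x; rewrite /rV_coord /= mxE.
Qed.

Lemma rV_consK : cancel rV_cons rV_uncons.
Proof.
move=> [a v]; rewrite /rV_uncons /rV_cons mxE unlift_none; congr pair.
by apply/rowP => j; rewrite !mxE liftK.
Qed.

End rV_cons.

Section lebesgue_rV_step.
Context {R : realType} {d : nat}.
Variable m : {sigma_finite_measure set 'rV[R]_d -> \bar R}.

Definition lebesgue_rVS : set 'rV[R]_d.+1 -> \bar R :=
  pushforward (@lebesgue_measure R \x m)%E (@rV_cons R d).

Let lebesgue_rVS0 : lebesgue_rVS set0 = 0%E.
Proof. by rewrite /lebesgue_rVS /pushforward preimage_set0 measure0. Qed.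

Let lebesgue_rVS_ge0 A : (0 <= lebesgue_rVS A)%E.
Proof. by rewrite /lebesgue_rVS /pushforward; exact: measure_ge0. Qed.

Let lebesgue_rVS_sigma_additive : semi_sigma_additive lebesgue_rVS.
Proof.
by apply: measure_semi_sigma_additive => //; exact: measurable_rV_cons.
Qed.

HB.instance Definition _ := isMeasure.Build _ _ _ lebesgue_rVS
  lebesgue_rVS0 lebesgue_rVS_ge0 lebesgue_rVS_sigma_additive.

Let lebesgue_rVS_sigma_finite : sigma_finite [set: 'rV[R]_d.+1] lebesgue_rVS.
Proof.
have /sigma_finiteP[F [TF ndF Foo]] := sigma_finiteT (@lebesgue_measure R).
have /sigma_finiteP[G [TG ndG Goo]] := sigma_finiteT m.
exists (fun n => rV_uncons @^-1` (F n `*` G n)).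
  rewrite -preimage_bigcup; apply/esym/seteqP; split => // x _ /=.
  have [n _ Fn] : (\bigcup_n F n) (rV_uncons x).1 by rewrite -TF.
  have [k _ Gk] : (\bigcup_n G n) (rV_uncons x).2 by rewrite -TG.
  exists (maxn n k) => //; split.
  - by move: Fn; exact/subsetPset/ndF/leq_maxl.
  - by move: Gk; exact/subsetPset/ndG/leq_maxr.
move=> n; have [mF Fn] := Foo n; have [mG Gn] := Goo n; split.
  rewrite -[X in measurable X]setTI; apply: measurable_rV_uncons => //.
  exact: measurableX.
rewrite /lebesgue_rVS /pushforward -comp_preimage.
rewrite (_ : _ \o _ = id); last by apply/funext => z; exact: rV_consK.
by rewrite preimage_id product_measure1E// lte_mul_pinfty// ge0_fin_numE.
Qed.

HB.instance Definition _ := Measure_isSigmaFinite.Build _ _ _ lebesgue_rVS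
  lebesgue_rVS_sigma_finite.

End lebesgue_rV_step.

(* Lebesgue measure on R^d, by recursion on d as the image of the product
   measure on R * R^(d-1); on the one-point space R^0 it is the unit mass. *)
Fixpoint lebesgue_rV (R : realType) (d : nat) :
    {sigma_finite_measure set 'rV[R]_d -> \bar R} :=
  match d with
  | 0 => \d_(0 : 'rV[R]_0)
  | d'.+1 => lebesgue_rVS (lebesgue_rV R d')
  end.

Section calculus.
Context {R : realType}.

(* f is of class C^k on the open set U: for directions ranging over a
   finite-dimensional space E, this is the usual definition by iterated
   partial derivatives. *)
Fixpoint Ck_open (E : normedModType R) (k : nat) (U : set E) (f : E -> R) : Prop :=
  (forall x, U x -> {for x, continuous f}) /\
  match k with
  | 0 => True
  | k'.+1 => forall v : E, (forall x, U x -> derivable f x v) /\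
               Ck_open k' U (fun x => 'D_v f x)
  end.

(* On a closed set K, C^k functions are restrictions to K of C^k functions on a
   neighbourhood of K; functions are total, so f itself is the extension. *)
Definition Ck_on (E : normedModType R) (k : nat) (K : set E) (f : E -> R) : Prop :=
  exists U : set E, [/\ open U, K `<=` U & Ck_open k U f].

Definition smooth_open (E : normedModType R) (U : set E) (f : E -> R) : Prop :=
  forall k, Ck_open k U f.

Definition grad (d : nat) (f : 'rV[R]_d -> R) (x : 'rV[R]_d) : 'rV[R]_d :=
  \row_i 'D_(delta_mx ord0 i) f x.

Definition sqnorm (d : nat) (x : 'rV[R]_d) : R := \sum_(i < d) x ord0 i ^+ 2.

(* Near each boundary point, Omega is a strict sublevel set of a smooth function
   with non-vanishing gradient. *)
Definition smooth_boundary (d : nat) (Omega : set 'rV[R]_d) : Prop :=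
  forall a, (closure Omega `\` Omega) a ->
  exists (U : set 'rV[R]_d) (psi : 'rV[R]_d -> R),
    [/\ open U, U a, smooth_open U psi,
        forall x, U x -> grad psi x != 0 &
        Omega `&` U = [set x | U x /\ psi x < 0]].

Definition test_function (d : nat) (Omega : set 'rV[R]_d)
    (phi : 'rV[R]_d -> R) : Prop :=
  smooth_open setT phi /\
  exists K : set 'rV[R]_d,
    [/\ compact K, K `<=` Omega & forall x, ~ K x -> phi x = 0].

Local Open Scope ereal_scope.

Definition weak_gradient (d : nat) (Omega : set 'rV[R]_d) (u : 'rV[R]_d -> R)
    (G : 'rV[R]_d -> 'rV[R]_d) : Prop :=
  forall phi, test_function Omega phi -> forall i : 'I_d,
    \int[lebesgue_rV R d]_(x in Omega) (u x * grad phi x ord0 i)%:E =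
    - \int[lebesgue_rV R d]_(x in Omega) (G x ord0 i * phi x)%:E.

(* The Dirichlet integral of u over Omega is finite, with the gradient taken in
   the weak sense; applied to the square root of a density of mu it expresses
   that the Fisher information is finite. *)
Definition finite_dirichlet (d : nat) (Omega : set 'rV[R]_d)
    (u : 'rV[R]_d -> R) : Prop :=
  exists G : 'rV[R]_d -> 'rV[R]_d,
    [/\ measurable_fun Omega G, weak_gradient Omega u G &
        \int[lebesgue_rV R d]_(x in Omega) (sqnorm (G x))%:E < +oo].

End calculus.

Section transport.
Context {R : realType}.
Local Open Scope ereal_scope.

(* Gamma(mu, nu).  Measures on a Borel subset of R^d are encoded as measures on
   R^d concentrated on it; a coupling of mu and nu is then automatically
   concentrated on the product of the subsets. *)
Definition coupling d1 d2 (T1 : measurableType d1) (T2 : measurableType d2)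
    (mu : set T1 -> \bar R) (nu : set T2 -> \bar R) :
    set (probability (T1 * T2)%type R) :=
  [set g | (forall A, measurable A -> g (A `*` setT) = mu A) /\
           (forall B, measurable B -> g (setT `*` B) = nu B)].

Definition W2 (d : nat) (p q : set 'rV[R]_d -> \bar R) : \bar R :=
  sqrte (ereal_inf [set \int[g]_z (sqnorm (z.1 - z.2))%:E | g in coupling p q]).

Section fiberwise.
Context {d : nat} {dY} {Y : measurableType dY}.
Notation X := 'rV[R]_d.
Variable nu : probability Y R.

Definition disintegration (rho : probability (X * Y)%type R) :
    set (R.-pker Y ~> X) :=
  [set k : R.-pker Y ~> X | forall A B, measurable A -> measurable B ->
     rho (A `*` B) = \int[nu]_(y in B) k y A].

(* The fiber-wise 2-Wasserstein distance.  Since R^d is Polish, disintegrations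
   exist as soon as the second marginal is nu, and they are unique up to nu-null
   sets: the infimum below ranges over a single value. *)
Definition W2F (rho1 rho2 : probability (X * Y)%type R) : \bar R :=
  sqrte (ereal_inf [set w | exists k1 k2 : R.-pker Y ~> X,
    [/\ disintegration rho1 k1, disintegration rho2 k2 &
        w = \int[nu]_y (W2 (k1 y) (k2 y)) ^+ 2]]).

End fiberwise.

(* The functional minimized in one step, of length tau and started at rho0, of
   the minimizing movement scheme without entropic term (kappa = 0). *)
Definition mms_functional (d d' : nat) (X : set 'rV[R]_d) (Y : set 'rV[R]_d')
    (nu : probability 'rV[R]_d' R) (V : 'rV[R]_d * 'rV[R]_d' -> R) (tau : R)
    (rho0 rho : probability ('rV[R]_d * 'rV[R]_d')%type R) : \bar R :=
  ((2 * tau)^-1)%:E * (W2F nu rho rho0) ^+ 2 +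
  \int[rho]_(z in X `*` Y) (V z)%:E.

Definition is_minimizer (T : Type) (D : set T) (J : T -> \bar R) (a : T) : Prop :=
  D a /\ forall b, D b -> J a <= J b.

End transport.

(* Main.v *)
Require Import Defs.
From HB Require Import structures.
From mathcomp Require Import all_boot all_order all_algebra.
From mathcomp Require Import all_classical all_reals all_analysis.
From mathcomp Require Import measurable_realfun ring lra.

Import Order.TTheory GRing.Theory Num.Theory.
Import numFieldNormedType.Exports.

Local Open Scope classical_set_scope.
Local Open Scope ring_scope.

(** The heart of the matter is the pointwise inequality
      V(x,y) - Pi(x) <= V(x',y) - Pi(x') + C |x - x'|^2
    for all x, x' in X and y in Y such that grad_X V(x,y) = grad Pi(x), that is,
    for all (x,y) in the graph of T.  Near the diagonal x = x' it is a
    second-order Taylor estimate, V and Pi being C^2 on a neighbourhood of the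
    compact sets X * Y and X; away from the diagonal it holds because V and Pi
    are bounded; compactness makes C uniform.

    Integrating this inequality against a coupling of the fibers rho_y and
    rho0_y, then over nu, the contributions of Pi cancel, since rho and rho0
    have the same first marginal, and
      \int V drho0 <= \int V drho + C W_F(rho, rho0)^2,
    which gives the theorem as soon as C <= 1 / (2 tau). *)

(** * Second-order estimates from partial derivatives *)

Section coordinatewise_calculus.
Set Implicit Arguments.
Unset Strict Implicit.
Context {R : realType}.
Implicit Types (d : nat).

Lemma is_derive_line (E : normedModType R) (g : E -> R) (p v : E) (t : R) dg :
  is_derive (p + t *: v) v g dg -> is_derive t 1 (fun s => g (p + s *: v)) dg.
Proof.
have e : (fun h : R => h^-1 *: (g (p + (h *: (1 : R) + t) *: v) - g (p + t *: v)))
   = (fun h => h^-1 *: (g (h *: v + (p + t *: v)) - g (p + t *: v))).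
  apply/funext => h; congr (_ *: (g _ - _)).
  by rewrite scalerDl addrCA /GRing.scale/= mulr1.
move=> [dv <-]; split; first by rewrite /derivable /= e.
by rewrite /derive /= e.
Qed.

(** Mean value theorem. The interval of radius |b - a| centred at a contains the segment from a to b
    whichever of the two is larger, so callers need not know the sign of b - a. *)
Lemma bounded_derive_lipschitz (psi dpsi : R -> R) (a b N : R) :
  (forall s, `|s - a| <= `|b - a| -> is_derive s 1 psi (dpsi s)) ->
  (forall s, `|s - a| <= `|b - a| -> `|dpsi s| <= N) ->
  `|psi b - psi a| <= N * `|b - a|.
Proof.
move=> der bnd; have [ab|/ltW ba] := leP a b.
- have in_seg s : s \in `[a, b] -> `|s - a| <= `|b - a|.
    rewrite in_itv /= => /andP[as_ sb].
    by rewrite !ger0_norm ?subr_ge0// lerD2r.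
  have [s sab||s sab ->] := @MVT_segment _ psi dpsi a b ab.
  + by apply: der; apply: in_seg; exact: subset_itv_oo_cc.
  + apply: derivable_within_continuous => s sab.
    by have [] := der _ (in_seg _ sab).
  + by rewrite normrM ler_wpM2r// bnd// in_seg.
- have in_seg s : s \in `[b, a] -> `|s - a| <= `|b - a|.
    rewrite in_itv /= => /andP[bs sa].
    by rewrite !ler0_norm ?subr_le0// lerN2 lerD2r.
  rewrite distrC [`|b - a|]distrC.
  have [s sab||s sab ->] := @MVT_segment _ psi dpsi b a ba.
  + by apply: der; apply: in_seg; exact: subset_itv_oo_cc.
  + apply: derivable_within_continuous => s sab.
    by have [] := der _ (in_seg _ sab).
  + by rewrite normrM ler_wpM2r// bnd// in_seg.
Qed.

(** The box is centred at x rather than spanned by x and x': membership then involves no orientation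
    of the coordinates, and boxes around the same centre are nested. *)
Definition coord_box d (x x' : 'rV[R]_d) : set 'rV[R]_d :=
  [set q | forall i, `|q ord0 i - x ord0 i| <= `|x' ord0 i - x ord0 i|].

Definition norm1 d (x : 'rV[R]_d) : R := \sum_i `|x ord0 i|.

Lemma sqnorm_ge0 d (x : 'rV[R]_d) : 0 <= sqnorm x.
Proof. by apply: sumr_ge0 => i _; exact: sqr_ge0. Qed.

(** Cauchy-Schwarz against the all-ones vector: expand the square and bound each product |a||b| by
    (a^2 + b^2) / 2. *)
Lemma norm1_sqr_le d (x : 'rV[R]_d) : norm1 x ^+ 2 <= d%:R * sqnorm x.
Proof.
rewrite /norm1 /sqnorm expr2 mulr_suml.
under eq_bigr do rewrite mulr_sumr.
apply: (@le_trans _ _ (\sum_(i < d) \sum_(j < d)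
    ((x ord0 i ^+ 2 + x ord0 j ^+ 2) / 2))).
  apply: ler_sum => i _; apply: ler_sum => j _.
  rewrite -(real_normK (num_real (x ord0 i))) -(real_normK (num_real (x ord0 j))).
  have := sqr_ge0 (`|x ord0 i| - `|x ord0 j|); nra.
under eq_bigr => i _ do rewrite -mulr_suml big_split/= sumr_const card_ord.
rewrite -mulr_suml big_split/= sumr_const card_ord sumrMnl.
by rewrite -mulr_natl; lra.
Qed.

(* Moving one coordinate at a time only involves partial derivatives, so that
   no differentiability in the Frechet sense is needed. *)
Lemma coord_box_lipschitz d (g : 'rV[R]_d -> R) (G : 'I_d -> 'rV[R]_d -> R)
    (x x' : 'rV[R]_d) (N : R) :
  (forall q i, coord_box x x' q -> is_derive q (delta_mx ord0 i) g (G i q)) ->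
  (forall q i, coord_box x x' q -> `|G i q| <= N) ->
  `|g x' - g x| <= N * norm1 (x' - x).
Proof.
move=> der bnd.
pose p (k : nat) : 'rV[R]_d :=
  \row_j (if (j < k)%N then x' ord0 j else x ord0 j).
have pd : p d = x' by apply/rowP => j; rewrite mxE ltn_ord.
have p0 : p 0%N = x by apply/rowP => j; rewrite mxE.
suff H k : (k <= d)%N ->
    `|g (p k) - g x| <= N * \sum_(i < d | (i < k)%N) `|(x' - x) ord0 i|.
  rewrite -{1}pd; apply: le_trans (H d (leqnn d)) _.
  by rewrite /norm1 (eq_bigl xpredT)// => i; rewrite ltn_ord.
elim: k => [_|k IH kd]; first by rewrite p0 subrr normr0 big_pred0 ?mulr0.
pose i := Ordinal kd.
have pS : p k.+1 = p k + (x' ord0 i - x ord0 i) *: delta_mx ord0 i.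
  apply/rowP => j; rewrite !mxE eqxx/= ltnS leq_eqVlt.
  have -> : (j == i) = (j == k :> nat) by [].
  case: eqP => [jk|] /=; last by rewrite mulr0 addr0.
  rewrite jk ltnn mulr1 (_ : j = i) ?subrKC//; exact/val_inj.
(* On this leg of the path every coordinate other than i is already that of x or of x', and
   coordinate i leaves that of x by at most the half-width of the box. *)
have box s : `|s - 0| <= `|x' ord0 i - x ord0 i - 0| ->
    coord_box x x' (p k + s *: delta_mx ord0 i).
  rewrite !subr0 => hs j; rewrite !mxE eqxx/=.
  have [->|ji] := eqVneq j i.
    by rewrite [(i < k)%N]ltnn mulr1 [_ + s]addrC addrK.
  by rewrite mulr0 addr0; case: ifP => _; rewrite ?subrr ?normr0 ?lexx.
have step : `|g (p k.+1) - g (p k)| <= N * `|(x' - x) ord0 i|.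
  have := @bounded_derive_lipschitz (fun s => g (p k + s *: delta_mx ord0 i))
    (fun s => G i (p k + s *: delta_mx ord0 i)) 0 (x' ord0 i - x ord0 i) N.
  rewrite scale0r addr0 -pS subr0 !mxE; apply => s hs.
  - by apply: is_derive_line; apply: der; apply: box; move: hs; rewrite !subr0.
  - by apply: bnd; apply: box; move: hs; rewrite !subr0.
rewrite (bigD1 i)//= mulrDr -(subrKA (g (p k))).
rewrite (le_trans (ler_normD _ _))// lerD//.
apply: le_trans (IH (ltnW kd)) _.
rewrite le_eqVlt; apply/orP; left; apply/eqP; congr (_ * _).
by apply: eq_bigl => j; rewrite ltnS ltn_neqAle andbC.
Qed.

Lemma coord_box_trans d (x x' q : 'rV[R]_d) : coord_box x x' q ->
  coord_box x q `<=` coord_box x x'.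
Proof. by move=> xq r qr i; exact: le_trans (qr i) (xq i). Qed.

Lemma coord_box_norm1 d (x x' q : 'rV[R]_d) : coord_box x x' q ->
  norm1 (q - x) <= norm1 (x' - x).
Proof. by move=> xq; apply: ler_sum => i _; move: (xq i); rewrite !mxE. Qed.

(** The Lipschitz estimate is used twice. Since each [G i] vanishes at x, bounded second derivatives
    give |G i q| <= M norm1 (q - x), hence at most M norm1 (x' - x) on the whole box. This in turn
    bounds the increment of g by M norm1 (x' - x)^2, and Cauchy-Schwarz produces the factor d. *)
Lemma critical_point_quadratic d (g : 'rV[R]_d -> R) (G : 'I_d -> 'rV[R]_d -> R)
    (H : 'I_d -> 'I_d -> 'rV[R]_d -> R) (x x' : 'rV[R]_d) (M : R) :
  0 <= M ->
  (forall q i, coord_box x x' q -> is_derive q (delta_mx ord0 i) g (G i q)) ->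
  (forall q i j, coord_box x x' q ->
     is_derive q (delta_mx ord0 j) (G i) (H i j q)) ->
  (forall q i j, coord_box x x' q -> `|H i j q| <= M) ->
  (forall i, G i x = 0) ->
  `|g x' - g x| <= M * d%:R * sqnorm (x' - x).
Proof.
move=> M0 der1 der2 bnd crit.
apply: (@le_trans _ _ (M * norm1 (x' - x) * norm1 (x' - x))).
  apply: coord_box_lipschitz der1 _ => q i xq.
  rewrite -[G i q]subr0 -(crit i).
  apply: (@le_trans _ _ (M * norm1 (q - x))).
    by apply: (@coord_box_lipschitz _ _ (H i)) => r j /(coord_box_trans xq);
      [exact: der2|exact: bnd].
  by rewrite ler_wpM2l// coord_box_norm1.
by rewrite -!mulrA -expr2 ler_wpM2l// norm1_sqr_le.
Qed.

End coordinatewise_calculus.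

(** * The uniform quadratic inequality on the compact sets *)

Section quadratic_bound.
Context {R : realType}.
Set Implicit Arguments.
Unset Strict Implicit.

(** Because P is monotone in its constant, a local constant also works for all larger ones;
    compactness, in the form of a near covering for the filter of C tending to infinity, then gives
    one constant for all of K. *)
Lemma compact_uniform_bound (T : topologicalType) (K : set T)
    (P : R -> T -> Prop) :
  compact K -> (forall a b x, a <= b -> P a x -> P b x) ->
  (forall x, K x -> exists C, \forall x' \near x, P C x') ->
  exists2 C : R, 0 < C & forall x, K x -> P C x.
Proof.
move=> /compact_near_coveringP cK Pmono Ploc.
have /= near_bound : \forall C \near +oo%R, K `<=` P C.
  apply: cK => x /Ploc[C PC].
  exists (P C, [set D | C <= D]).
    by split; [exact: PC|exact: nbhs_pinfty_ge (num_real C)].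
  by case=> x' D [/= PCx' CD]; exact: Pmono CD PCx'.
have [C [C0 KC]] := filter_ex (filterI (nbhs_pinfty_gt (num_real (0 : R))) near_bound).
by exists C.
Qed.

Lemma norm_le_near (a b : R) : `|a - b| < 1 -> `|b| <= `|a| + 1.
Proof.
by move=> ab; rewrite -lerBlDl (le_trans (lerB_dist _ _))// distrC; exact: ltW.
Qed.

Lemma entry_le_sum (n : nat) (F : 'I_n -> 'I_n -> R) (i j : 'I_n) :
  (forall i j, 0 <= F i j) -> F i j <= \sum_i \sum_j F i j.
Proof.
move=> F0; apply: (@le_trans _ _ (\sum_j F i j)).
  by rewrite [leRHS](bigD1 j)//= lerDl sumr_ge0.
by rewrite [leRHS](bigD1 i)//= lerDl; apply: sumr_ge0 => ? _; exact: sumr_ge0.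
Qed.

Lemma compact_continuous_bounded (T : topologicalType) (K : set T) (g : T -> R) :
  compact K -> (forall x, K x -> {for x, continuous g}) ->
  exists2 M : R, 0 < M & forall x, K x -> `|g x| <= M.
Proof.
move=> cK cg; apply: (@compact_uniform_bound _ _ (fun M x => `|g x| <= M) cK).
  by move=> a b x ab /le_trans; apply.
move=> x Kx; exists (`|g x| + 1).
have /cvgr_dist_lt/(_ 1 ltr01) := cg _ Kx; apply: filterS => x' xx'.
exact: norm_le_near.
Qed.

Variables d d' : nat.
Implicit Types (V : 'rV[R]_d * 'rV[R]_d' -> R) (Pi : 'rV[R]_d -> R).

Let slice_quotient V (v x : 'rV[R]_d) (y : 'rV[R]_d') :
  (fun h : R => h^-1 *: (V (h *: v + x, y) - V (x, y))) =
  (fun h : R => h^-1 *: (V (h *: (v, 0) + (x, y)) - V (x, y))).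
Proof.
apply/funext => h; congr (_ *: (V _ - _)).
by congr pair; rewrite /= scaler0 add0r.
Qed.

Lemma derive_slice V (v x : 'rV[R]_d) (y : 'rV[R]_d') :
  'D_v (fun x' => V (x', y)) x = 'D_(v, 0) V (x, y).
Proof. by rewrite /derive /= slice_quotient. Qed.

Lemma derivable_slice V (v x : 'rV[R]_d) (y : 'rV[R]_d') :
  derivable V (x, y) (v, 0) -> derivable (fun x' => V (x', y)) x v.
Proof. by rewrite /derivable /= slice_quotient. Qed.

Lemma is_derive_slice V (v x : 'rV[R]_d) (y : 'rV[R]_d') :
  derivable V (x, y) (v, 0) ->
  is_derive x v (fun x' => V (x', y)) ('D_(v, 0) V (x, y)).
Proof.
by move=> dV; split; [exact: derivable_slice|exact: derive_slice].
Qed.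

(** The estimate near a diagonal point (a, a, b): the second derivatives are continuous at (a, b),
    hence bounded on a ball, in which [critical_point_quadratic] applies. *)
Lemma critical_quadratic_near (U : set ('rV[R]_d * 'rV[R]_d')) V
    (U' : set 'rV[R]_d) Pi (a : 'rV[R]_d) (b : 'rV[R]_d') :
  open U -> Ck_open 2 U V -> open U' -> Ck_open 2 U' Pi ->
  U (a, b) -> U' a ->
  exists C e : R, 0 < e /\ forall x x' y,
    ball a e x -> ball a e x' -> ball b e y ->
    grad (fun z => V (z, y)) x = grad Pi x ->
    `|(V (x', y) - Pi x') - (V (x, y) - Pi x)| <= C * sqnorm (x' - x).
Proof.
move=> oU [_ CV] oU' [_ CPi] Uab U'a.
pose e_ (i : 'I_d) : 'rV[R]_d := delta_mx ord0 i.
(* [G] and [H] are the gradient and the Hessian, in the variable x, of V(x,y) - Pi(x). *)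
pose G i (z : 'rV[R]_d * 'rV[R]_d') := 'D_(e_ i, 0) V z - 'D_(e_ i) Pi z.1.
pose H i j (z : 'rV[R]_d * 'rV[R]_d') :=
  'D_(e_ j, 0) ('D_(e_ i, 0) V) z - 'D_(e_ j) ('D_(e_ i) Pi) z.1.
have H_cont i j : {for (a, b), continuous (H i j)}.
  apply: cvgB.
    by have [_ [_ /(_ (e_ j, 0))[_ [c _]]]] := CV (e_ i, 0); exact: c.
  apply: (cvg_comp fst ('D_(e_ j) ('D_(e_ i) Pi))); first exact: cvg_fst.
  by have [_ [_ /(_ (e_ j))[_ [c _]]]] := CPi (e_ i); exact: c.
(* The sum serves as a maximum over the entries; the added 1 leaves room for their variation near
   (a, b). *)
pose M := \sum_i \sum_j (`|H i j (a, b)| + 1).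
have M0 : 0 <= M by do 2 apply: sumr_ge0 => ? _; exact: addr_ge0.
have H_near : \forall z \near (a, b), forall i j, `|H i j z| <= M.
  apply: (@filter_forall _ 'I_d (fun i z => forall j, `|H i j z| <= M) _
    (nbhs_filter (a, b))) => i.
  apply: (@filter_forall _ 'I_d (fun j z => `|H i j z| <= M) _
    (nbhs_filter (a, b))) => j.
  have /cvgr_dist_lt/(_ 1 ltr01) := H_cont i j; apply: filterS => z Hz.
  apply: (@le_trans _ _ (`|H i j (a, b)| + 1)).
    exact: norm_le_near Hz.
  by apply: (@entry_le_sum _ (fun i j => `|H i j (a, b)| + 1)) => *; exact: addr_ge0.
have U_near : \forall z \near (a, b), U z by exact: open_nbhs_nbhs.
have U'_near : \forall z \near (a, b), U' z.1.
  by apply: (cvg_fst (F := nbhs a) (G := nbhs b)); exact: open_nbhs_nbhs.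
have good_near : nbhs (a, b)
    [set z | (forall i j, `|H i j z| <= M) /\ (U z /\ U' z.1)].
  exact: filterI H_near (filterI U_near U'_near).
move: good_near => /nbhs_ballP[e /= e0 good].
(* With x and x' within e / 3 of a, the box has half-widths below 2e / 3, so its points stay within
   e of a. *)
exists (M * d%:R), (e / 3); split; first by rewrite divr_gt0.
move=> x x' y ax ax' bY crit.
have box_ball q : coord_box x x' q -> ball (a, b) e (q, y).
  move=> xq; split => /=; last by apply: le_ball bY; lra.
  split=> // k i; rewrite ord1.
  have := xq i; have := ax.2 ord0 i; have := ax'.2 ord0 i; rewrite /ball/=.
  rewrite !ltr_norml !ler_norml => /andP[? ?] /andP[? ?].
  have [?|?] := leP (x ord0 i) (x' ord0 i).
    rewrite ger0_norm ?subr_ge0// => /andP[? ?]; apply/andP; split; lra.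
  rewrite ltr0_norm ?subr_lt0// => /andP[? ?]; apply/andP; split; lra.
apply: (@critical_point_quadratic R d (fun z => V (z, y) - Pi z)
  (fun i z => G i (z, y)) (fun i j z => H i j (z, y))) => //.
- move=> q i /box_ball/good[_ [Uq U'q]]; apply: is_deriveB.
    by apply: is_derive_slice; have [+ _] := CV (e_ i, 0); exact.
  by apply: DeriveDef => //; have [+ _] := CPi (e_ i); exact.
- move=> q i j /box_ball/good[_ [Uq U'q]]; apply: is_deriveB.
    apply: is_derive_slice.
    by have [_ [_ /(_ (e_ j, 0))[+ _]]] := CV (e_ i, 0); exact.
  apply: DeriveDef => //.
  by have [_ [_ /(_ (e_ j))[+ _]]] := CPi (e_ i); exact.
- by move=> q i j /box_ball/good[+ _]; exact.
- move=> i; apply/eqP; rewrite subr_eq0 -derive_slice; apply/eqP.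
  by move/rowP/(_ i): crit; rewrite !mxE.
Qed.

Lemma critical_quadratic_lower_bound (X : set 'rV[R]_d) (Y : set 'rV[R]_d') V Pi :
  compact X -> compact Y -> Ck_on 2 (X `*` Y) V -> Ck_on 2 X Pi ->
  exists2 C : R, 0 < C & forall x x' y, X x -> X x' -> Y y ->
    grad (fun z => V (z, y)) x = grad Pi x ->
    V (x, y) - Pi x <= V (x', y) - Pi x' + C * sqnorm (x' - x).
Proof.
move=> cX cY [U [oU XYU CV]] [U' [oU' XU' CPi]].
have cXY : compact (X `*` Y) by exact: compact_setX.
have [M1 M10 VM] := compact_continuous_bounded cXY (fun z Kz => CV.1 z (XYU z Kz)).
have [M2 M20 PiM] := compact_continuous_bounded cX (fun z Kz => CPi.1 z (XU' z Kz)).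
(* The memberships are premises inside [P] because the local bound is required on a full
   neighbourhood, which may leave the compact set. *)
pose P (C : R) (p : 'rV[R]_d * 'rV[R]_d * 'rV[R]_d') :=
  X p.1.1 -> X p.1.2 -> Y p.2 -> grad (fun z => V (z, p.2)) p.1.1 = grad Pi p.1.1 ->
  `|(V (p.1.2, p.2) - Pi p.1.2) - (V (p.1.1, p.2) - Pi p.1.1)| <=
  C * sqnorm (p.1.2 - p.1.1).
have [||[[a a'] b] [[/= Xa Xa'] Yb]|C C0 PC] :=
    @compact_uniform_bound _ (X `*` X `*` Y) P.
- by apply: compact_setX => //; exact: compact_setX.
- move=> C1 C2 p C12 PC Xx Xx' Yy g.
  by apply: (le_trans (PC Xx Xx' Yy g)); rewrite ler_wpM2r// sqnorm_ge0.
- have [<-|/eqP aa'] := eqVneq a a'.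
    have [C [e [e0 Ce]]] := critical_quadratic_near oU CV oU' CPi
      (XYU (a, b) (conj Xa Yb)) (XU' _ Xa).
    exists C; apply/nbhs_ballP; exists e => // -[[x x'] y] [[/= ax ax'] bY] _ _ _.
    exact: Ce.
  have [i /eqP ai] : exists i, a ord0 i <> a' ord0 i.
    by apply/existsNP => aE; apply: aa'; apply/rowP.
  (* The i-th coordinates of a and a' are 3 [dl] apart, so points of the [dl]-balls around them
     differ by more than [dl] in that coordinate. Thus sqnorm (x' - x) is at least [dl]^2, while V -
     Pi varies by at most 2 (M1 + M2); the quotient of these bounds is the constant. *)
  pose dl := `|a ord0 i - a' ord0 i| / 3.
  have dl0 : 0 < dl by rewrite divr_gt0// normr_gt0 subr_eq0.
  exists (2 * (M1 + M2) / dl ^+ 2); apply/nbhs_ballP; exists dl => //.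
  move=> [[x x'] y] [[/= ax ax'] bY] /= Xx Xx' Yy _.
  apply: (@le_trans _ _ (2 * (M1 + M2))).
    have := VM (x, y) (conj Xx Yy); have := VM (x', y) (conj Xx' Yy).
    have := PiM _ Xx; have := PiM _ Xx'; rewrite !ler_norml.
    by move=> /andP[? ?] /andP[? ?] /andP[? ?] /andP[? ?]; apply/andP; split; lra.
  rewrite -mulrA ler_peMr//; first by rewrite mulr_ge0// addr_ge0// ltW.
  rewrite mulrC ler_pdivlMr ?exprn_gt0// mul1r.
  apply: (@le_trans _ _ ((x' - x) ord0 i ^+ 2)); last first.
    by rewrite /sqnorm (bigD1 i)//= lerDl; apply: sumr_ge0 => j _; exact: sqr_ge0.
  rewrite -[leRHS]real_normK ?num_real// ler_sqr ?nnegrE ?(ltW dl0)//.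
  have := ax.2 ord0 i; have := ax'.2 ord0 i; rewrite /ball/= !mxE.
  have : `|a ord0 i - a' ord0 i| = 3 * dl by rewrite /dl; field.
  have -> : a ord0 i - a' ord0 i =
    (a ord0 i - x ord0 i) + (x ord0 i - x' ord0 i) - (a' ord0 i - x' ord0 i) by ring.
  have := ler_normB ((a ord0 i - x ord0 i) + (x ord0 i - x' ord0 i)) (a' ord0 i - x' ord0 i).
  have := ler_normD (a ord0 i - x ord0 i) (x ord0 i - x' ord0 i).
  by rewrite (distrC (x' ord0 i)); lra.
exists C => // x x' y Xx Xx' Yy g.
have := PC (x, x', y) (conj (conj Xx Xx') Yy) Xx Xx' Yy g.
by rewrite /= ler_norml => /andP[+ _]; lra.
Qed.

End quadratic_bound.

(** * Borel measurability on row vectors and their products *)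

Section borel.
Context {R : realType}.
Set Implicit Arguments.
Unset Strict Implicit.

(** Use the balls with centre in the dense family and radius 1/(k+1) that are contained in O, the
    others being replaced by the empty set. If the e-ball around x lies in O and 1/(k+1) < e / 2, a
    centre within 1/(k+1) of x gives such a ball, and it contains x. *)
Lemma open_bigcup_countable_balls (T : pseudoMetricType R) (D : countType)
    (q : D -> T) (O : set T) :
  (forall x e, 0 < e -> exists i, ball x e (q i)) -> open O ->
  exists F : D * nat -> set T,
    (forall p, F p = set0 \/ exists e, F p = ball (q p.1) e) /\
    O = \bigcup_p F p.
Proof.
move=> q_dense oO.
pose F (p : D * nat) :=
  if `[< ball (q p.1) p.2.+1%:R^-1 `<=` O >] then ball (q p.1) p.2.+1%:R^-1
  else set0.
exists F; split.
  by move=> p; rewrite /F; case: asboolP => _; [right; exists p.2.+1%:R^-1|left].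
apply/seteqP; split=> [x Ox|x [p _]]; last first.
  by rewrite /F; case: asboolP => // + ?; exact.
have /nbhs_ballP[e /= e0 xeO] : nbhs x O by exact: open_nbhs_nbhs.
have [k ke] : exists k : nat, k.+1%:R^-1 < e / 2.
  have e20 : 0 < e / 2 by rewrite divr_gt0.
  exists (Num.truncn (e / 2)^-1).
  rewrite -[ltRHS]invrK ltf_pV2 ?posrE ?invr_gt0//.
  by rewrite truncnS_gt.
have k0 : 0 < k.+1%:R^-1 :> R by rewrite invr_gt0.
have [i xi] := q_dense x _ k0.
exists (i, k) => //; rewrite /F /=; case: asboolP => [_|]; first exact: ball_sym.
case=> z iz; apply: xeO; rewrite [e]splitr.
by apply: (@ball_triangle _ _ (q i)); [apply: le_ball xi|apply: le_ball iz];
  exact: ltW.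
Qed.

Lemma measurable_countable_forall d (T : measurableType d) (I : countType)
    (P : I -> T -> Prop) :
  (forall i, measurable [set x | P i x]) -> measurable [set x | forall i, P i x].
Proof.
move=> mP.
have -> : [set x | forall i, P i x] = ~` \bigcup_i ~` [set x | P i x].
  rewrite setC_bigcup; apply/seteqP; split=> x /= Px.
    by move=> i _ nP; exact: nP (Px i).
  by move=> i; exact: contrapT (Px i Logic.I).
apply: measurableC; apply: countable_bigcupT_measurable => // i.
exact: measurableC.
Qed.

Lemma measurable_ball_rV n (x : 'rV[R]_n) e : measurable (ball x e).
Proof.
(* A ball of row vectors carries the condition 0 < e, which the coordinate balls alone do not record
   when n = 0. *)
have [e0|e0] := ltP 0 e; last first.
  rewrite (_ : ball x e = set0) ?measurable0// -subset0 => y [] .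
  by rewrite ltNge e0.
have -> : ball x e = [set y | forall i, ball (x ord0 i) e (y ord0 i)].
  apply/seteqP; split=> y /= => [[_ xy] i|xy]; first exact: xy.
  by split=> // k i; rewrite ord1; exact: xy.
apply: measurable_countable_forall => i.
rewrite -[X in measurable X]setTI.
by apply: (@measurable_rV_coord R n i) => //; exact: measurable_ball.
Qed.

Definition rat_rV n (v : 'rV[rat]_n) : 'rV[R]_n := map_mx ratr v.

Lemma rat_rV_dense n (x : 'rV[R]_n) e : 0 < e ->
  exists v, ball x e (@rat_rV n v).
Proof.
move=> e0.
have /choice[v xv] (i : 'I_n) : exists r : rat, `|x ord0 i - ratr r| < e.
  have [r] : exists r : rat, ratr r \in `](x ord0 i - e), (x ord0 i + e)[.
    by apply: rat_in_itvoo; lra.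
  by rewrite in_itv/= => /andP[? ?]; exists r; rewrite ltr_norml; apply/andP; split; lra.
by exists (\row_i v i); split=> // k i; rewrite ord1 !mxE; exact: xv.
Qed.

(** The sigma-algebra is generated by the coordinates, so this rests on separability: an open set is
    a countable union of balls with rational centres, and balls are finite intersections of
    coordinate conditions. *)
Lemma open_measurable_rV n (O : set 'rV[R]_n) : open O -> measurable O.
Proof.
move=> /(open_bigcup_countable_balls (@rat_rV_dense n))[F [FE ->]].
apply: countable_bigcupT_measurable => // p.
by have [->|[e ->]] := FE p; [exact: measurable0|exact: measurable_ball_rV].
Qed.

Lemma open_measurable_rV_prod n m (O : set ('rV[R]_n * 'rV[R]_m)) :
  open O -> measurable O.
Proof.
pose q (v : 'rV[rat]_n * 'rV[rat]_m) := (@rat_rV n v.1, @rat_rV m v.2).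
have q_dense x e : 0 < e -> exists v, ball x e (q v).
  move=> e0; have [v1 ?] := rat_rV_dense x.1 e0; have [v2 ?] := rat_rV_dense x.2 e0.
  by exists (v1, v2).
move=> /(open_bigcup_countable_balls q_dense)[F [FE ->]].
apply: countable_bigcupT_measurable => // p.
have [->|[e ->]] := FE p; first exact: measurable0.
by apply: measurableX; exact: measurable_ball_rV.
Qed.

Lemma closed_measurable_rV n (K : set 'rV[R]_n) : closed K -> measurable K.
Proof. by move=> /closed_openC/open_measurable_rV/measurableC; rewrite setCK. Qed.

Lemma open_preimage_continuous (T : topologicalType) (U : set T) (f : T -> R) :
  open U -> (forall x, U x -> {for x, continuous f}) ->
  forall O, open O -> open (U `&` f @^-1` O).
Proof.
move=> oU cf O oO; rewrite openE => x [Ux Ofx]; apply: filterI.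
  exact: open_nbhs_nbhs.
by apply: cf => //; exact: open_nbhs_nbhs.
Qed.

Lemma measurable_fun_open_preimage d (T : measurableType d) (U : set T) (f : T -> R) :
  (forall O, open O -> measurable (U `&` f @^-1` O)) -> measurable_fun U f.
Proof.
move=> mf mU; apply: (measurability _ (RGenOpens.measurableE R)) => //.
move=> _ [_ [a [b ->] <-]]; apply: mf; exact: interval_open.
Qed.

Lemma continuous_measurable_rV n (U : set 'rV[R]_n) (f : 'rV[R]_n -> R) :
  open U -> (forall x, U x -> {for x, continuous f}) -> measurable_fun U f.
Proof.
move=> oU cf; apply: measurable_fun_open_preimage => O oO.
by apply: open_measurable_rV; exact: open_preimage_continuous.
Qed.

Lemma continuous_measurable_rV_prod n m (U : set ('rV[R]_n * 'rV[R]_m))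
    (f : 'rV[R]_n * 'rV[R]_m -> R) :
  open U -> (forall x, U x -> {for x, continuous f}) -> measurable_fun U f.
Proof.
move=> oU cf; apply: measurable_fun_open_preimage => O oO.
by apply: open_measurable_rV_prod; exact: open_preimage_continuous.
Qed.

Lemma measurable_sqnormB n :
  measurable_fun setT (fun z : 'rV[R]_n * 'rV[R]_n => sqnorm (z.1 - z.2)).
Proof.
apply: measurable_sum => i; apply: measurable_funX.
rewrite (_ : (fun _ => _) = (fun z : 'rV[R]_n * 'rV[R]_n =>
  rV_coord i z.1 - rV_coord i z.2)); last by apply/funext => z; rewrite !mxE.
by apply: measurable_funB; (apply: measurableT_comp; first exact: measurable_rV_coord).
Qed.

End borel.

(** * Integration along a disintegration *)

Section integration.
Context {R : realType}.
Set Implicit Arguments.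
Unset Strict Implicit.
Local Open Scope ereal_scope.

Import HBNNSimple.

(* The upper function need not be measurable: in [W2F], the map sending y to the
   squared distance of the fibers over y is not known to be. *)
Lemma le_integral_nonmeasurable d (T : measurableType d)
    (m : {measure set T -> \bar R}) (f g : T -> \bar R) :
  (forall x, 0 <= f x) -> (forall x, f x <= g x) ->
  \int[m]_x f x <= \int[m]_x g x.
Proof.
move=> f0 fg; rewrite !ge0_integralTE//; last first.
  by move=> x; exact: le_trans (fg x).
apply: ereal_sup_le => _ [h hf <-] /=; exists h => //= x.
exact: le_trans (fg x).
Qed.

Section kernel_integral.
Context d1 d2 (T1 : measurableType d1) (T2 : measurableType d2).
Variables (nu : probability T2 R) (k : R.-pker T2 ~> T1).
Variable rho : probability (T1 * T2)%type R.
Hypothesis rhoE : forall A B, measurable A -> measurable B ->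
  rho (A `*` B) = \int[nu]_(y in B) k y A.

(** The kernel has its source in the second factor; exchanging the factors turns y-sections into
    x-sections of a set on T2 times T1. *)
Let flip (z : T2 * T1) := (z.2, z.1).

Let mflip : measurable_fun setT flip.
Proof. exact: measurable_fun_pair measurable_snd measurable_fst. Qed.

Lemma measurable_kernel_ysection (C : set (T1 * T2)) : measurable C ->
  measurable_fun setT (fun y => k y (ysection C y)).
Proof.
move=> mC; have mC' : measurable (flip @^-1` C).
  by rewrite -[X in measurable X]setTI; exact: mflip.
rewrite (_ : (fun y => _) = (fun y => k y (xsection (flip @^-1` C) y))).
  by apply: measurable_fun_xsection_finite_kernel; rewrite inE.
by apply/funext => y; congr (k y _); apply/seteqP; split=> x;
  rewrite /ysection /xsection /= !inE.
Qed.

Lemma measurable_kernel_integral (f : T1 * T2 -> \bar R) :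
  (forall z, 0 <= f z) -> measurable_fun setT f ->
  measurable_fun setT (fun y => \int[k y]_x f (x, y)).
Proof.
move=> f0 mf.
apply: (@measurable_fun_integral_finite_kernel _ _ _ _ _ (f \o flip) k) => //.
  by move=> z; exact: f0.
by apply: measurableT_comp => //; exact: mflip.
Qed.

Let mass (C : set (T1 * T2)) := \int[nu]_y k y (ysection C y).

Let mass0 : mass set0 = 0.
Proof. by rewrite /mass integral0_eq// => y _; rewrite ysection0 measure0. Qed.

Let mass_ge0 C : 0 <= mass C.
Proof. by apply: integral_ge0. Qed.

Let mass_additive : semi_sigma_additive mass.
Proof.
move=> F mF tF mUF.
rewrite [X in _ --> X](_ : _ = \sum_(n <oo) mass (F n)).
  apply: is_cvg_nneseries => n _ _; exact: mass_ge0.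
rewrite /mass -integral_nneseries//; last first.
  by move=> n; exact: measurable_kernel_ysection.
apply: eq_integral => y _; rewrite ysection_bigcup.
have mFy i : measurable (ysection (F i) y) by exact: measurable_ysection.
rewrite measure_semi_bigcup//; first exact: trivIset_ysection.
exact: bigcup_measurable.
Qed.

HB.instance Definition _ := isMeasure.Build _ _ _ mass mass0 mass_ge0 mass_additive.

(** [rho] and [mass] agree on rectangles by [rhoE]. Rectangles are stable under intersection and
    generate the product sigma-algebra, and [rho] is finite, so the two measures coincide. *)
Lemma disintegration_measure C : measurable C ->
  rho C = \int[nu]_y k y (ysection C y).
Proof.
move=> mC; rewrite -/(mass C).
apply: (measure_unique [set A `*` B | A in measurable & B in measurable]
  (fun=> setT) _ _ _ _ rho mass).
- by rewrite measurable_prod_measurableType.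
- move=> _ _ [A1 mA1 [B1 mB1 <-]] [A2 mA2 [B2 mB2 <-]].
  exists (A1 `&` A2); first exact: measurableI.
  by exists (B1 `&` B2); [exact: measurableI|rewrite setXI].
- by move=> _; exists setT => //; exists setT => //; rewrite setXTT.
- by apply/seteqP; split=> // z _; exists 0%N.
- move=> _ [A mA [B mB <-]]; apply: (etrans (rhoE mA mB)).
  rewrite /mass integral_mkcond /=.
  apply: eq_integral => y _; rewrite /patch; case: ifPn => yB.
    by rewrite in_ysectionX.
  by rewrite notin_ysectionX// measure0.
- by move=> _; rewrite [X in X < _](@probability_setT _ _ _ rho) ltry.
- by [].
Qed.

(** Simple functions reduce to [disintegration_measure] on their level sets. Monotone convergence is
    then applied under [rho], under [nu] and under each [k y]. *)
Lemma disintegration_integral (f : T1 * T2 -> \bar R) :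
  (forall z, 0 <= f z) -> measurable_fun setT f ->
  \int[rho]_z f z = \int[nu]_y \int[k y]_x f (x, y).
Proof.
move=> f0 mf; pose f_ := nnsfun_approx measurableT mf.
have f_cvg z : (f_ n z)%:E @[n --> \oo] --> f z by exact: cvg_nnsfun_approx.
have f_nd z (a b : nat) : (a <= b)%N -> (f_ a z)%:E <= (f_ b z)%:E.
  by move=> ab; rewrite lee_fin; exact/lefP/nd_nnsfun_approx.
have mslice n y : measurable_fun setT (fun x => (f_ n (x, y))%:E).
  by apply/measurable_EFinP; exact: measurable_fun_pair1.
have simple n : \int[rho]_z (f_ n z)%:E = \int[nu]_y \int[k y]_x (f_ n (x, y))%:E.
  rewrite integralT_nnsfun sintegralE.
  transitivity (\int[nu]_y \sum_(r \in range (f_ n))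
      (r%:E * k y (ysection (f_ n @^-1` [set r]) y))); last first.
    apply: eq_integral => y _.
    pose S r := ysection (f_ n @^-1` [set r]) y.
    have mS r : measurable (S r) by exact: measurable_ysection.
    (* Nonnegativity of the summands is checked for every real r, including values outside the
       range; for r < 0 the level set is empty and the term is 0. *)
    have S0 r : (r < 0)%R -> S r = set0.
      by move=> r0; rewrite /S preimage_nnfun0// ysection0.
    transitivity (\int[k y]_x \sum_(r \in range (f_ n)) (r%:E * (\1_(S r) x)%:E)).
      rewrite ge0_integral_fsum//; last 2 first.
      - by move=> r; apply: measurable_funeM; exact/measurable_EFinP.
      - move=> r x _; have [r0|r0] := leP 0%R r.
          by rewrite mule_ge0// lee_fin.
        by rewrite S0// indic0 mule0.
      apply: eq_fsbigr => r _; have [r0|r0] := leP 0%R r.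
        rewrite ge0_integralZl//; last exact/measurable_EFinP.
        by rewrite integral_indic// setIT.
      rewrite -/(S r) S0// measure0 mule0 integral0_eq// => x _.
      by rewrite indic0 mule0.
    apply: eq_integral => x _; rewrite fimfunE -fsumEFin//.
    apply: eq_fsbigr => r _; rewrite EFinM; congr (_ * _%:E).
    by rewrite !indicE mem_ysection.
  rewrite ge0_integral_fsum//; last 2 first.
  - move=> r; apply: measurable_funeM; exact: measurable_kernel_ysection.
  - move=> r y _; have [r0|r0] := leP 0%R r; first exact: mule_ge0.
    by rewrite preimage_nnfun0// ysection0 measure0 mule0.
  apply: eq_fsbigr => r _.
  have [r0|r0] := leP 0%R r.
    rewrite ge0_integralZl//; last exact: measurable_kernel_ysection.
    by rewrite -disintegration_measure.
  rewrite preimage_nnfun0// measure0 mule0 integral0_eq// => y _.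
  by rewrite ysection0 measure0 mule0.
transitivity (limn (fun n => \int[rho]_z (f_ n z)%:E)).
  rewrite -monotone_convergence//.
  - by apply: eq_integral => z _; apply/esym/cvg_lim => //.
  - by move=> n; exact/measurable_EFinP.
  - by move=> n z _; rewrite lee_fin.
  - by move=> z _ a b; exact: f_nd.
transitivity (limn (fun n => \int[nu]_y \int[k y]_x (f_ n (x, y))%:E)).
  by congr (limn _); apply/funext => n; exact: simple.
rewrite -monotone_convergence//; last 3 first.
- move=> n; apply: (@measurable_kernel_integral (fun z => (f_ n z)%:E)).
    by move=> z; rewrite lee_fin.
  exact/measurable_EFinP.
- by move=> n y _; apply: integral_ge0 => x _; rewrite lee_fin.
- move=> y _ a b ab; apply: ge0_le_integral => //.
    by move=> x _; rewrite lee_fin.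
  by move=> x _; exact: f_nd.
apply: eq_integral => y _; rewrite -monotone_convergence//; last 2 first.
- by move=> n x _; rewrite lee_fin.
- by move=> x _ a b; exact: f_nd.
by apply: eq_integral => x _; apply/cvg_lim => //.
Qed.

(** The masses of the sections are nonnegative with integral [rho C] = 0, hence vanish off a
    [nu]-null set. *)
Lemma disintegration_null C : measurable C -> rho C = 0 ->
  exists N, [/\ measurable N, nu N = 0 & forall y, ~ N y -> k y (ysection C y) = 0].
Proof.
move=> mC; rewrite disintegration_measure// => C0.
have mk := measurable_kernel_ysection mC.
have /(ae_eq_integral_abs nu measurableT mk)[N [mN N0 sN]] :
    \int[nu]_y `|k y (ysection C y)| = 0.
  by rewrite -[RHS]C0; apply: eq_integral => y _; rewrite gee0_abs.
exists N; split => // y Ny; apply/not_notP => ky; apply/Ny/sN => /(_ Logic.I).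
exact: ky.
Qed.

End kernel_integral.
End integration.

(** * Couplings, weak duality and the integrated inequality *)

Section transport_bound.
Context {R : realType}.
Set Implicit Arguments.
Unset Strict Implicit.
Local Open Scope ereal_scope.

(** Repackages a measure of total mass one, such as a fiber [k y], as a probability, so that its
    image under the diagonal map is a probability too. *)
Definition as_probability d (T : measurableType d) (m : {measure set T -> \bar R})
  (m1 : m setT = 1) : set T -> \bar R := m.

HB.instance Definition _ d (T : measurableType d) (m : {measure set T -> \bar R})
  (m1 : m setT = 1) := Measure.on (as_probability m1).

HB.instance Definition _ d (T : measurableType d) (m : {measure set T -> \bar R})
  (m1 : m setT = 1) := Measure_isProbability.Build _ _ _ (as_probability m1) m1.

Lemma integral_image_measure d1 d2 (T1 : measurableType d1) (T2 : measurableType d2)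
    (phi : T1 -> T2) (m : {measure set T1 -> \bar R}) (m' : {measure set T2 -> \bar R})
    (f : T2 -> \bar R) :
  measurable_fun setT phi -> (forall A, measurable A -> m' A = m (phi @^-1` A)) ->
  (forall x, 0 <= f x) -> measurable_fun setT f ->
  \int[m']_x f x = \int[m]_x f (phi x).
Proof.
move=> mphi m'E f0 mf.
rewrite (eq_measure_integral (pushforward m phi)); last by move=> A mA _; exact: m'E.
by rewrite ge0_integral_pushforward// preimage_setT.
Qed.

Lemma bounded_integral_fin_num d (T : measurableType d) (p : {measure set T -> \bar R})
    (u : T -> R) (K : R) :
  p setT = 1 -> measurable_fun setT u -> (forall x, 0 <= u x <= K)%R ->
  \int[p]_x (u x)%:E \is a fin_num.
Proof.
move=> p1 mu uK; have u0 x : (0 <= u x)%R by have /andP[] := uK x.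
rewrite ge0_fin_numE; last by apply: integral_ge0 => x _; rewrite lee_fin.
apply: (@le_lt_trans _ _ (\int[p]_x K%:E)).
  apply: ge0_le_integral => //.
  - by move=> x _; rewrite lee_fin.
  - exact/measurable_EFinP.
  - by move=> x _; rewrite lee_fin; have /andP[] := uK x.
by rewrite integral_cst// p1 mule1 ltry.
Qed.

Lemma coupling_fst d1 d2 (T1 : measurableType d1) (T2 : measurableType d2)
    (p : {measure set T1 -> \bar R}) (q : {measure set T2 -> \bar R})
    (g : probability (T1 * T2)%type R)
    (f : T1 -> \bar R) :
  coupling p q g -> (forall x, 0 <= f x) -> measurable_fun setT f ->
  \int[p]_x f x = \int[g]_z f z.1.
Proof.
move=> [g1 _]; apply: integral_image_measure; first exact: measurable_fst.
by move=> A mA; apply: (etrans (esym (g1 _ mA))); rewrite setXT.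
Qed.

Lemma coupling_snd d1 d2 (T1 : measurableType d1) (T2 : measurableType d2)
    (p : {measure set T1 -> \bar R}) (q : {measure set T2 -> \bar R})
    (g : probability (T1 * T2)%type R)
    (f : T2 -> \bar R) :
  coupling p q g -> (forall x, 0 <= f x) -> measurable_fun setT f ->
  \int[q]_x f x = \int[g]_z f z.2.
Proof.
move=> [_ g2]; apply: integral_image_measure; first exact: measurable_snd.
by move=> A mA; apply: (etrans (esym (g2 _ mA))); rewrite setTX.
Qed.

Lemma W2_sqr n (p q : set 'rV[R]_n -> \bar R) :
  W2 p q ^+ 2 =
  ereal_inf [set \int[g]_z (sqnorm (z.1 - z.2))%:E | g in coupling p q].
Proof.
rewrite sqr_sqrte//; apply: le_ereal_inf_tmp => _ [g _ <-].
by apply: integral_ge0 => z _; rewrite lee_fin sqnorm_ge0.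
Qed.

(** The image of m under the diagonal map is a coupling of m with itself of zero cost. *)
Lemma W2_refl n (m : {measure set 'rV[R]_n -> \bar R}) : m setT = 1 -> W2 m m = 0.
Proof.
move=> m1; pose p : probability _ R := as_probability m1.
change (W2 p p = 0).
pose diag (x : 'rV[R]_n) := (x, x).
have mdiag : measurable_fun setT diag by exact: measurable_fun_pair.
pose diag_mixin := isMeasurableFun.Build _ _ _ _ _ mdiag.
pose diag_pack : {mfun _ >-> _} := HB.pack diag diag_mixin.
pose g : probability _ R := distribution p diag_pack.
have gpp : coupling p p g.
  split=> A mA; rewrite /g /distribution /pushforward /=; congr (p _);
    by apply/seteqP; split=> x // -[].
rewrite /W2 (_ : ereal_inf _ = 0) ?sqrte0//.
apply/eqP; rewrite eq_le; apply/andP; split; last first.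
  apply: le_ereal_inf_tmp => _ [h _ <-].
  by apply: integral_ge0 => z _; rewrite lee_fin sqnorm_ge0.
apply: ereal_inf_lbound; exists g => //.
rewrite (@integral_image_measure _ _ _ _ diag p g)//.
- apply: integral0_eq => x _; rewrite /= subrr /sqnorm big1// => i _.
  by rewrite mxE expr0n.
- by move=> z; rewrite lee_fin sqnorm_ge0.
- by apply/measurable_EFinP; exact: measurable_sqnormB.
Qed.

(** The easy half of Kantorovich duality for the cost C |x' - x|^2: integrate the pointwise
    inequality against any coupling, with x' distributed as p and x as q, then take the infimum.
    Boundedness of u and b makes the difference of integrals meaningful. *)
Lemma W2_dual_bound n (p q : {measure set 'rV[R]_n -> \bar R}) (u b : 'rV[R]_n -> R)
    (P Q : set 'rV[R]_n) (C K : R) :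
  p setT = 1 -> q setT = 1 ->
  (0 < C)%R -> measurable P -> measurable Q -> p (~` P) = 0 -> q (~` Q) = 0 ->
  measurable_fun setT u -> measurable_fun setT b ->
  (forall x, 0 <= u x <= K)%R -> (forall x, 0 <= b x <= K)%R ->
  (forall x x', Q x -> P x' ->
     u x + b x' <= u x' + b x + C * sqnorm (x' - x))%R ->
  \int[q]_x (u x)%:E + \int[p]_x (b x)%:E -
    (\int[p]_x (u x)%:E + \int[q]_x (b x)%:E) <= C%:E * W2 p q ^+ 2.
Proof.
move=> p1 q1 C0 mP mQ pP qQ mu mb uK bK ineq; rewrite W2_sqr -lee_pdivrMl//.
apply: le_ereal_inf_tmp => _ [g gpq <-]; rewrite lee_pdivrMl//.
rewrite leeBlDl; last by rewrite fin_numD !(@bounded_integral_fin_num _ _ _ _ K).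
have u0 x : (0 <= u x)%R by have /andP[] := uK x.
have b0 x : (0 <= b x)%R by have /andP[] := bK x.
have mEu : measurable_fun setT (EFin \o u) by exact/measurable_EFinP.
have mEb : measurable_fun setT (EFin \o b) by exact/measurable_EFinP.
have msq := @measurable_sqnormB R n.
rewrite (coupling_snd (f := EFin \o u) gpq)// (coupling_fst (f := EFin \o b) gpq)//.
rewrite (coupling_fst (f := EFin \o u) gpq)// (coupling_snd (f := EFin \o b) gpq)//.
have mfst (f : 'rV[R]_n -> R) : measurable_fun setT f ->
    measurable_fun setT (fun z : 'rV[R]_n * 'rV[R]_n => (f z.1)%:E).
  by move=> mf; apply/measurable_EFinP; apply: measurableT_comp.
have msnd (f : 'rV[R]_n -> R) : measurable_fun setT f ->
    measurable_fun setT (fun z : 'rV[R]_n * 'rV[R]_n => (f z.2)%:E).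
  by move=> mf; apply/measurable_EFinP; apply: measurableT_comp.
have msqE : measurable_fun setT
    (fun z : 'rV[R]_n * 'rV[R]_n => (sqnorm (z.1 - z.2))%:E).
  exact/measurable_EFinP.
rewrite -ge0_integralZl//; last 2 first.
  by move=> z _; rewrite lee_fin sqnorm_ge0.
  by rewrite lee_fin ltW.
rewrite -!ge0_integralD//=; last 12 first.
- by move=> z _; rewrite adde_ge0// lee_fin.
- by apply: emeasurable_funD; [exact: mfst|exact: msnd].
- by move=> z _; rewrite mule_ge0// lee_fin ?sqnorm_ge0// ltW.
- exact: measurable_funeM.
- by move=> z _; rewrite lee_fin.
- exact: mfst.
- by move=> z _; rewrite lee_fin.
- exact: msnd.
- by move=> z _; rewrite lee_fin.
- exact: msnd.
- by move=> z _; rewrite lee_fin.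
- exact: mfst.
apply: ae_ge0_le_integral => //.
- by move=> z _; rewrite adde_ge0// lee_fin.
- by apply: emeasurable_funD; [exact: msnd|exact: mfst].
- move=> z _; rewrite !adde_ge0 ?lee_fin// mulr_ge0 ?sqnorm_ge0//; exact: ltW.
- apply: emeasurable_funD; last exact: measurable_funeM.
  by apply: emeasurable_funD; [exact: mfst|exact: msnd].
(* The pointwise inequality can fail only where the first point is outside P or the second outside
   Q; the marginals of g give this set measure zero. *)
exists ((~` P `*` setT) `|` (setT `*` ~` Q)); split.
- by apply: measurableU; apply: measurableX => //; exact: measurableC.
- have [g1 g2] := gpq; apply/eqP; rewrite eq_le measure_ge0 andbT.
  apply: (le_trans (measureU2 _ _ _)).
  + by apply: measurableX => //; exact: measurableC.
  + by apply: measurableX => //; exact: measurableC.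
  + rewrite [X in X + _]g1; last exact: measurableC.
    by rewrite [X in _ + X]g2 ?pP ?qQ ?adde0//; exact: measurableC.
- move=> z nz; apply: contrapT => Nz; apply: nz => _.
  rewrite -!EFinM -!EFinD lee_fin.
  by apply: ineq; apply: contrapT => h; apply: Nz; [right|left].
Qed.

(** Weak duality is applied in almost every fiber, with A(., y) in the role of V(., y) and b in that
    of Pi, and the result is integrated over [nu]. As b depends on x alone, its two integrals are
    equal and finite, and they cancel. *)
Lemma fiberwise_transport_bound n d (Y : measurableType d) (nu : probability Y R)
    (rho rho0 : probability ('rV[R]_n * Y)%type R) (k k0 : R.-pker Y ~> 'rV[R]_n)
    (A : 'rV[R]_n * Y -> R) (b : 'rV[R]_n -> R) (P Q : set ('rV[R]_n * Y)) (C K : R) :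
  (0 < C)%R -> measurable P -> measurable Q -> rho (~` P) = 0 -> rho0 (~` Q) = 0 ->
  disintegration nu rho k -> disintegration nu rho0 k0 ->
  measurable_fun setT A -> measurable_fun setT b ->
  (forall z, 0 <= A z <= K)%R -> (forall x, 0 <= b x <= K)%R ->
  (forall x x' y, Q (x, y) -> P (x', y) ->
     A (x, y) + b x' <= A (x', y) + b x + C * sqnorm (x' - x))%R ->
  \int[rho]_z (b z.1)%:E = \int[rho0]_z (b z.1)%:E ->
  \int[rho0]_z (A z)%:E <=
    \int[rho]_z (A z)%:E + C%:E * \int[nu]_y W2 (k y) (k0 y) ^+ 2.
Proof.
move=> C0 mP mQ rP rQ dk dk0 mA mb AK bK ineq eqb.
have A0 z : (0 <= A z)%R by have /andP[] := AK z.
have b0 x : (0 <= b x)%R by have /andP[] := bK x.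
have mEA : measurable_fun setT (EFin \o A) by exact/measurable_EFinP.
have mEb : measurable_fun setT (fun z : 'rV[R]_n * Y => (b z.1)%:E).
  by apply/measurable_EFinP; apply: measurableT_comp.
have [N [mN nuN kN]] := disintegration_null dk (measurableC mP) rP.
have [N0 [mN0 nuN0 kN0]] := disintegration_null dk0 (measurableC mQ) rQ.
pose iA (j : R.-pker Y ~> 'rV[R]_n) y := \int[j y]_x (A (x, y))%:E.
pose ib (j : R.-pker Y ~> 'rV[R]_n) y := \int[j y]_x (b x)%:E.
have iA0 j y : 0 <= iA j y by apply: integral_ge0 => x _; rewrite lee_fin.
have ib0 j y : 0 <= ib j y by apply: integral_ge0 => x _; rewrite lee_fin.
have miA j : measurable_fun setT (iA j).
  by apply: (@measurable_kernel_integral _ _ _ _ _ j (EFin \o A))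
    => // z; rewrite lee_fin.
have mib j : measurable_fun setT (ib j).
  by apply: (@measurable_kernel_integral _ _ _ _ _ j (fun z => (b z.1)%:E))
    => // z; rewrite lee_fin.
have fA j y : iA j y \is a fin_num.
  apply: (@bounded_integral_fin_num _ _ (j y) (fun x => A (x, y)) K) => //.
    exact: prob_kernel.
  exact: measurable_fun_pair1.
have fb j y : ib j y \is a fin_num.
  by apply: (@bounded_integral_fin_num _ _ (j y) b K) => //; exact: prob_kernel.
(* a measurable lower bound of the squared distance between the fibers *)
pose gap y := maxe 0 (C^-1%:E * (iA k0 y + ib k y - (iA k y + ib k0 y))).
have gap0 y : 0 <= gap y by rewrite /gap le_max lexx.
have mgap : measurable_fun setT gap.
  apply: measurable_maxe => //; apply: measurable_funeM.
  by apply: emeasurable_funB; exact: emeasurable_funD.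
have gapE : \int[nu]_y gap y <= \int[nu]_y W2 (k y) (k0 y) ^+ 2.
  (* Outside N and N0 the fibers of [rho] and [rho0] do not charge the complements of the sections
     of P and Q, as weak duality requires; on these null sets the integrand is replaced by 0. *)
  rewrite (@ge0_negligible_integral _ _ _ nu setT (N `|` N0))//; last 2 first.
    exact: measurableU.
    by rewrite measureU0.
  rewrite integral_mkcond; apply: le_integral_nonmeasurable => y.
    by apply: erestrict_ge0.
  have W0 : 0 <= W2 (k y) (k0 y) ^+ 2 by rewrite expe2 mule_ge0// sqrte_ge0.
  rewrite /patch; case: ifPn => // /[!inE] -[_ /not_orP[Ny N0y]].
  rewrite /gap ge_max W0 /= lee_pdivrMl//.
  apply: (@W2_dual_bound _ (k y) (k0 y) (fun x => A (x, y)) b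
    (ysection P y) (ysection Q y) C K) => //.
  - exact: prob_kernel.
  - exact: prob_kernel.
  - exact: measurable_ysection.
  - exact: measurable_ysection.
  - by rewrite -(kN y Ny); congr (k y _); rewrite /ysection; apply/seteqP; split=> x /=;
      rewrite !inE.
  - by rewrite -(kN0 y N0y); congr (k0 y _); rewrite /ysection; apply/seteqP; split=> x /=;
      rewrite !inE.
  - exact: measurable_fun_pair1.
  - by move=> x x'; rewrite /ysection /= !inE; exact: ineq.
have pointwise y : iA k0 y + ib k y <= iA k y + ib k0 y + C%:E * gap y.
  rewrite -leeBlDl; last by rewrite fin_numD fA fb.
  by rewrite -lee_pdivrMl// /gap le_max lexx orbT.
have mCgap : measurable_fun setT (fun y => C%:E * gap y) by exact: measurable_funeM.
have Cgap0 y : 0 <= C%:E * gap y by rewrite mule_ge0// lee_fin ltW.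
have le_int : \int[nu]_y (iA k0 y + ib k y) <=
    \int[nu]_y (iA k y + ib k0 y + C%:E * gap y).
  apply: ge0_le_integral => //.
  - by move=> y _; exact: adde_ge0.
  - exact: emeasurable_funD.
  - by apply: emeasurable_funD => //; exact: emeasurable_funD.
have split_l : \int[nu]_y (iA k0 y + ib k y) =
    \int[nu]_y iA k0 y + \int[nu]_y ib k y by rewrite ge0_integralD.
have split_r : \int[nu]_y (iA k y + ib k0 y + C%:E * gap y) =
    \int[nu]_y iA k y + \int[nu]_y ib k0 y + C%:E * \int[nu]_y gap y.
  rewrite ge0_integralD//; last 2 first.
  - by move=> y _; exact: adde_ge0.
  - exact: emeasurable_funD.
  by rewrite ge0_integralD// ge0_integralZl// lee_fin ltW.
have rhoA : \int[rho]_z (A z)%:E = \int[nu]_y iA k y.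
  by apply: (disintegration_integral dk (f := EFin \o A)) => // z; rewrite lee_fin.
have rho0A : \int[rho0]_z (A z)%:E = \int[nu]_y iA k0 y.
  by apply: (disintegration_integral dk0 (f := EFin \o A)) => // z; rewrite lee_fin.
have rhob : \int[rho]_z (b z.1)%:E = \int[nu]_y ib k y.
  by apply: (disintegration_integral dk (f := fun z => (b z.1)%:E)) => // z; rewrite lee_fin.
have rho0b : \int[rho0]_z (b z.1)%:E = \int[nu]_y ib k0 y.
  by apply: (disintegration_integral dk0 (f := fun z => (b z.1)%:E)) => // z; rewrite lee_fin.
have fin_b : \int[rho0]_z (b z.1)%:E \is a fin_num.
  apply: (@bounded_integral_fin_num _ _ rho0 (fun z => b z.1) K) => //.
  - exact: probability_setT.
  - exact/measurable_EFinP.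
move: le_int; rewrite split_l split_r -rhoA -rho0A -rhob -rho0b eqb.
rewrite addeAC leeD2rE// => /le_trans; apply.
by rewrite leeD2l// lee_pmul2l.
Qed.

End transport_bound.

(** * The squared fiber-wise distance as an infimum *)

Section fiberwise_distance.
Context {R : realType} {d : nat} {dY : measure_display} {Y : measurableType dY}.
Set Implicit Arguments.
Unset Strict Implicit.
Local Open Scope ereal_scope.
Variable nu : probability Y R.
Implicit Types rho : probability ('rV[R]_d * Y)%type R.

Lemma W2F_sqr rho rho' : W2F nu rho rho' ^+ 2 =
  ereal_inf [set w | exists k k' : R.-pker Y ~> 'rV[R]_d,
    [/\ disintegration nu rho k, disintegration nu rho' k' &
        w = \int[nu]_y (W2 (k y) (k' y)) ^+ 2]].
Proof.
rewrite sqr_sqrte//; apply: le_ereal_inf_tmp => _ [k [k' [_ _ ->]]].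
by apply: integral_ge0 => y _; rewrite expe2 mule_ge0// sqrte_ge0.
Qed.

Lemma W2F_refl rho (k : R.-pker Y ~> 'rV[R]_d) :
  disintegration nu rho k -> W2F nu rho rho ^+ 2 = 0.
Proof.
move=> dk; apply/eqP; rewrite eq_le; apply/andP; split; last first.
  by rewrite expe2 mule_ge0// sqrte_ge0.
rewrite W2F_sqr; apply: ereal_inf_lbound; exists k, k; split => //.
rewrite integral0_eq// => y _.
by rewrite W2_refl ?expe2 ?mul0e//; exact: prob_kernel.
Qed.

Lemma W2F_no_disintegration rho rho' :
  ~ (exists k, disintegration nu rho' k) -> W2F nu rho rho' ^+ 2 = +oo.
Proof.
move=> nk; rewrite W2F_sqr (_ : [set w | _] = set0) ?ereal_inf0//.
by rewrite -subset0 => w [k [k' [_ dk' _]]]; apply: nk; exists k'.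
Qed.

End fiberwise_distance.

(** * Minimality of [rho0] for small time steps *)

Lemma closure_bounded (R : realType) (E : normedModType R) (S : set E) :
  bounded_set S -> bounded_set (closure S).
Proof.
move=> [M [Mreal SM]]; exists M; split=> // N MN.
have clN : closed [set x : E | `|x| <= N].
  by apply: (preimage_closed _ (@closed_le _ _)) => y _; exact: norm_continuous.
have SN : S `<=` [set x : E | `|x| <= N] by move=> x Sx; exact: SM.
by have := closureS SN; rewrite -((closure_id _).1 clN).
Qed.

Theorem mainTheorem4 (R : realType) (d d' : nat)
  (Omega X : set 'rV[R]_d) (Y : set 'rV[R]_d')
  (Omega_open : open Omega) (Omega_bounded : bounded_set Omega)
  (Omega_connected : connected Omega)
  (Omega_smooth : smooth_boundary Omega)
  (X_def : X = closure Omega)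
  (Y_compact : compact Y)
  (mu : probability 'rV[R]_d R) (f : 'rV[R]_d -> R)
  (f_meas : measurable_fun X f)
  (mu_density : forall A, measurable A ->
     mu A = (\int[lebesgue_rV R d]_(x in A `&` X) (f x)%:E)%E)
  (f_bounds : exists m M : R, 0 < m /\ forall x, X x -> m <= f x <= M)
  (f_fisher : finite_dirichlet Omega (fun x => Num.sqrt (f x)))
  (nu : probability 'rV[R]_d' R) (nu_Y : nu Y = 1%E)
  (V : 'rV[R]_d * 'rV[R]_d' -> R)
  (V_C2 : Ck_on 2 (X `*` Y) V)
  (V_ge0 : forall x y, X x -> Y y -> 0 <= V (x, y))
  (V_twist : forall x, X x -> set_inj Y (fun y => grad (fun x' => V (x', y)) x))
  (Pi : 'rV[R]_d -> R) (Pi_C2 : Ck_on 2 X Pi)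
  (T : 'rV[R]_d -> 'rV[R]_d')
  (T_def : forall x, X x ->
     Y (T x) /\ grad (fun x' => V (x', T x)) x = grad Pi x)
  (T_push : forall B, measurable B -> mu (X `&` T @^-1` B) = nu B)
  (rho0 : probability ('rV[R]_d * 'rV[R]_d')%type R)
  (rho0_def : forall C, measurable C ->
     rho0 C = mu (X `&` (fun x => (x, T x)) @^-1` C)) :
  exists tau0 : R, 0 < tau0 /\
    forall tau, 0 < tau < tau0 ->
      is_minimizer (coupling mu nu) (mms_functional X Y nu V tau rho0) rho0.
Proof.
have cX : compact X.
  apply: bounded_closed_compact; last by rewrite X_def; exact: closed_closure.
  by rewrite X_def; exact: closure_bounded.
have clX : closed X by rewrite X_def; exact: closed_closure.
have mX : measurable X by exact: closed_measurable_rV.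
have mY : measurable Y.
  by apply: closed_measurable_rV; apply: compact_closed => //; exact: norm_hausdorff.
have mXY : measurable (X `*` Y) by exact: measurableX.
(* The density formula integrates over the part of A in X only, so [mu] is concentrated on X. *)
have muX : mu X = 1%E.
  rewrite -(probability_setT mu) !mu_density// setTI setIid//.
have muXI A : measurable A -> mu (X `&` A) = mu A.
  move=> mA; rewrite !mu_density//; last exact: measurableI.
  by rewrite setIAC setIid setIC.
have rho0_coupling : coupling mu nu rho0.
  split=> B mB; rewrite rho0_def//.
  - rewrite -(muXI B)//; congr (mu _).
    by apply/seteqP; split=> x /=; tauto.
  - exact: measurableX.
  - rewrite -T_push//; congr (mu _).
    by apply/seteqP; split=> x /=; tauto.
  - exact: measurableX.
have [C C0 quad] := critical_quadratic_lower_bound cX Y_compact V_C2 Pi_C2.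
have [U [oU XYU CV]] := V_C2; have [U' [oU' XU' CPi]] := Pi_C2.
have [M1 M10 VM] := compact_continuous_bounded (compact_setX cX Y_compact)
  (fun z Kz => CV.1 z (XYU z Kz)).
have [M2 M20 PiM] := compact_continuous_bounded cX (fun z Kz => CPi.1 z (XU' z Kz)).
have mU : measurable U by exact: open_measurable_rV_prod.
have mU' : measurable U' by exact: open_measurable_rV.
have mV : measurable_fun (X `*` Y) V.
  apply: (measurable_funS mU XYU).
  by apply: continuous_measurable_rV_prod => //; exact: CV.1.
have mPi : measurable_fun X Pi.
  apply: (measurable_funS mU' XU').
  by apply: continuous_measurable_rV => //; exact: CPi.1.
(* V and Pi are controlled only near the compact sets, so they are extended by 0 to functions that
   are globally measurable. Adding [M2] makes Pi nonnegative on X without affecting differences; [K]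
   bounds both A <= M1 and b <= 2 M2. *)
pose A := V \_ (X `*` Y).
pose b := (fun x => Pi x + M2) \_ X.
pose K := M1 + 2 * M2.
have AE z : (X `*` Y) z -> A z = V z by move=> Kz; rewrite /A patchE mem_set.
have bE x : X x -> b x = Pi x + M2 by move=> Xx; rewrite /b patchE mem_set.
have mA : measurable_fun setT A by apply/(measurable_restrictT _ _).1.
have mb : measurable_fun setT b.
  by apply/(measurable_restrictT _ _).1 => //; exact: measurable_funD.
have AK z : 0 <= A z <= K.
  rewrite /A patchE; case: ifPn => [/set_mem Kz|_].
    have := VM z Kz; rewrite ler_norml => /andP[_ ?].
    have Vz0 : 0 <= V z by clear -V_ge0 Kz; case: z Kz => x y [Xx Yy]; exact: V_ge0.
    by rewrite Vz0 /K; lra.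
  (* Off the product the restriction takes the default value [point], which is 0 in R. *)
  by rewrite -[point]/(0 : R) lexx/= /K; lra.
have bK x : 0 <= b x <= K.
  rewrite /b patchE; case: ifPn => [/set_mem Xx|_].
    have := PiM x Xx; rewrite ler_norml => /andP[? ?].
    by apply/andP; split; rewrite /K; lra.
  by rewrite -[point]/(0 : R) lexx/= /K; lra.
(* [G] stands in for the graph of T: it contains the graph over X, and it is measurable because it
   is cut out by equations between continuous partial derivatives. *)
pose G := (X `*` Y) `&`
  [set z | forall i, 'D_(delta_mx ord0 i, 0) V z = 'D_(delta_mx ord0 i) Pi z.1].
have mG : measurable G.
  pose D (i : 'I_d) z := 'D_(delta_mx ord0 i, 0) V z - 'D_(delta_mx ord0 i) Pi z.1.
  (* The product of X and Y is intersected once more because the condition over ['I_d] is vacuous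
     when d = 0. *)
  rewrite (_ : G = [set z | forall i, ((X `*` Y) `&` D i @^-1` [set 0]) z] `&` (X `*` Y)).
    apply: measurableI => //; apply: measurable_countable_forall => i.
    have mD : measurable_fun (X `*` Y) (D i).
      apply: measurable_funB.
        apply: (measurable_funS mU XYU); apply: continuous_measurable_rV_prod => //.
        by have [_ [c _]] := CV.2 (delta_mx ord0 i, 0); exact: c.
      apply: (measurable_comp (f := 'D_(delta_mx ord0 i) Pi) (g := fst) mX).
      + by move=> _ [z [Xz _] <-].
      + apply: (measurable_funS mU' XU'); apply: continuous_measurable_rV => //.
        by have [_ [c _]] := CPi.2 (delta_mx ord0 i); exact: c.
      + exact: measurable_funTS.
    exact: mD.
  apply/seteqP; split=> z /=.
    by case=> Kz zG; split => // i; split => //; rewrite /D zG subrr.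
  by case=> zG Kz; split => // i; have [_ /eqP] := zG i; rewrite subr_eq0 => /eqP.
have gradG x y : G (x, y) -> grad (fun z => V (z, y)) x = grad Pi x.
  by case=> _ xyG; apply/rowP => i; rewrite !mxE derive_slice; exact: xyG.
have rho0G : rho0 (~` G) = 0%E.
  rewrite rho0_def; last exact: measurableC.
  rewrite (_ : _ `&` _ = set0) ?measure0//.
  rewrite -subset0 => x [Xx]; apply; have [YTx gx] := T_def _ Xx.
  by split=> // i; rewrite -derive_slice; move/rowP/(_ i): gx; rewrite !mxE.
have bound (rho : probability ('rV[R]_d * 'rV[R]_d')%type R) : coupling mu nu rho ->
    (\int[rho0]_(z in X `*` Y) (V z)%:E <=
     \int[rho]_(z in X `*` Y) (V z)%:E + C%:E * W2F nu rho rho0 ^+ 2)%E.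
  move=> rho_coupling.
  have VA (r : probability ('rV[R]_d * 'rV[R]_d')%type R) :
      (\int[r]_(z in X `*` Y) (V z)%:E = \int[r]_z (A z)%:E)%E.
    by rewrite integral_mkcond restrict_EFin.
  rewrite !VA.
  have rhoXY : rho (~` (X `*` Y)) = 0%E.
    have [rho1 rho2] := rho_coupling.
    have muX0 : mu (~` X) = 0%E by rewrite probability_setC// muX subee.
    have nuY0 : nu (~` Y) = 0%E by rewrite probability_setC// nu_Y subee.
    have mXc : measurable (~` X `*` [set: 'rV[R]_d']).
      by apply: measurableX => //; exact: measurableC.
    have mYc : measurable ([set: 'rV[R]_d] `*` ~` Y).
      by apply: measurableX => //; exact: measurableC.
    have rhoX : rho (~` X `*` [set: 'rV[R]_d']) = 0%E.
      by apply: (etrans (rho1 _ _)) => //; exact: measurableC.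
    have rhoY : rho ([set: 'rV[R]_d] `*` ~` Y) = 0%E.
      by apply: (etrans (rho2 _ _)) => //; exact: measurableC.
    apply: (subset_measure0 _ (measurableU _ _ mXc mYc)).
    - exact: measurableC.
    - by move=> [x y] /not_andP[nx|ny]; [left|right].
    - exact: etrans (measureU0 mXc mYc rhoY) rhoX.
  have key k k0 : disintegration nu rho k -> disintegration nu rho0 k0 ->
      (\int[rho0]_z (A z)%:E <=
        \int[rho]_z (A z)%:E + C%:E * \int[nu]_y W2 (k y) (k0 y) ^+ 2)%E.
    move=> dk dk0.
    apply: (@fiberwise_transport_bound _ _ _ _ nu rho rho0 k k0 A b (X `*` Y) G C K) => //.
    - move=> x x' y xyG [Xx' _]; have [[Xx Yy] _] := xyG.
      rewrite !AE// !bE//; have := quad x x' y Xx Xx' Yy (gradG _ _ xyG); lra.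
    - have mEb : measurable_fun setT (EFin \o b) by exact/measurable_EFinP.
      have b0 x : (0 <= (b x)%:E)%E by rewrite lee_fin; have /andP[] := bK x.
      by rewrite -(coupling_fst (f := EFin \o b) rho_coupling)//
        -(coupling_fst (f := EFin \o b) rho0_coupling).
  have finA : (\int[rho]_z (A z)%:E \is a fin_num)%E.
    by apply: (bounded_integral_fin_num (K := K)) => //; exact: probability_setT.
  (* As the integral of A under [rho] is finite, the inequality can be solved for the transport
     cost; it holds for every pair of disintegrations and so passes to the infimum. *)
  rewrite -leeBlDl// -lee_pdivrMl// W2F_sqr.
  apply: le_ereal_inf_tmp => _ [k [k0 [dk dk0 ->]]].
  by rewrite lee_pdivrMl// leeBlDl//; exact: key.
(* For tau below this threshold, C <= 1 / (2 tau), so the movement cost dominates the possible gain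
   in potential energy. *)
exists (2 * C)^-1; split; first by rewrite invr_gt0 mulr_gt0.
move=> tau /andP[tau0 tauC]; split => // rho rho_coupling.
have W0 r : (0 <= W2F nu r rho0 ^+ 2)%E by rewrite expe2 mule_ge0// sqrte_ge0.
have intV0 : (0 <= \int[rho]_(z in X `*` Y) (V z)%:E)%E.
  by apply: integral_ge0 => -[x y] [/= Xx Yy]; rewrite lee_fin V_ge0.
have ht : 0 < (2 * tau)^-1 by rewrite invr_gt0 mulr_gt0.
(* If rho0 had no disintegration, W2F would be the infimum of the empty set, +oo:
   the existence of disintegrations need not be proved. *)
have [[k dk]|nk] := pselect (exists k, disintegration nu rho0 k); last first.
  rewrite {2}/mms_functional W2F_no_disintegration// gt0_muley ?lte_fin//.
  by rewrite addye ?leey// -ltNye (lt_le_trans _ intV0).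
rewrite /mms_functional (W2F_refl dk) mule0 add0e.
apply: (le_trans (bound _ rho_coupling)); rewrite addeC leeD2r// lee_wpmul2r//.
rewrite lee_fin -[leLHS]invrK lef_pV2 ?posrE ?invr_gt0 ?mulr_gt0//.
move: tauC; rewrite invfM -(ltr_pM2l (ltr0n R 2)) mulrA divff// mul1r.
exact: ltW.
Qed.
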